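(* Let $\mathbb F$ be a field and let $\hat H$ be the universal double affine Hecke algebra of type $(C_1^\vee,C_1)$ over $\mathbb F$. In $\hat H$ the elements $$x = t^\vee_0 t_1 + (t^\vee_0 t_1)^{-1},\qquad y = t^\vee_1 t_1 + (t^\vee_1 t_1)^{-1},\qquad z = t_0 t_1 + (t_0 t_1)^{-1}$$ are related as follows: $$Qxy-Q^{-1}yx+(Q^2-Q^{-2})z=(Q-Q^{-1})\big((t^\vee_0+t^{\vee -1}_0)(t^\vee_1+t^{\vee -1}_1)+(t_0+t^{-1}_0)(Q^{-1}t_1+Qt^{-1}_1)\big),$$ $$Qyz-Q^{-1}zy+(Q^2-Q^{-2})x=(Q-Q^{-1})\big((t^\vee_1+t^{\vee -1}_1)(t_0+t^{-1}_0)+(t^\vee_0+t^{\vee -1}_0)(Q^{-1}t_1+Qt^{-1}_1)\big),$$ $$Qzx-Q^{-1}xz+(Q^2-Q^{-2})y=(Q-Q^{-1})\big((t_0+t^{-1}_0)(t^\vee_0+t^{\vee -1}_0)+(t^\vee_1+t^{\vee -1}_1)(Q^{-1}t_1+Qt^{-1}_1)\big).$$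
   Context: All algebras are associative with $1$. $\hat H$ is the $\mathbb F$-algebra defined by generators $t_i^{\pm1}$, $(t_i^\vee)^{\pm1}$ $(i=0,1)$ and relations: $t_it_i^{-1}=t_i^{-1}t_i=1$, $t^\vee_it^{\vee -1}_i=t^{\vee -1}_it^\vee_i=1$; $t_i+t_i^{-1}$ is central and $t^\vee_i+t^{\vee -1}_i$ is central $(i=0,1)$; $t^\vee_0t_0t^\vee_1t_1$ is central. Here $t^{\vee -1}_i=(t^\vee_i)^{-1}$. The element $t^\vee_0t_0t^\vee_1t_1$ is invertible and $Q$ denotes its inverse. *)

(* Defs.v *)
From HB Require Import structures.
From mathcomp Require Import all_boot all_algebra.
From mathcomp Require Import boolp.
From mathcomp Require Import finmap monalg.

Set Implicit Arguments.
Unset Strict Implicit.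
Unset Printing Implicit Defensive.

Import GRing.Theory.
Import Quotient.

Local Open Scope ring_scope.
Local Open Scope quotient_scope.

(* The eight generators; GTinv and GTvinv stand for the formal inverses
   t_i^-1 and (t_i^vee)^-1. *)
Inductive daha_gen : Type :=
  | GT of 'I_2 | GTinv of 'I_2 | GTv of 'I_2 | GTvinv of 'I_2.

Definition daha_gen_code (g : daha_gen) : ('I_2 + 'I_2) + ('I_2 + 'I_2) :=
  match g with
  | GT i => inl (inl i) | GTinv i => inl (inr i)
  | GTv i => inr (inl i) | GTvinv i => inr (inr i)
  end.

Definition daha_gen_decode (s : ('I_2 + 'I_2) + ('I_2 + 'I_2)) : daha_gen :=
  match s with
  | inl (inl i) => GT i | inl (inr i) => GTinv i
  | inr (inl i) => GTv i | inr (inr i) => GTvinv i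
  end.

Lemma daha_gen_codeK : cancel daha_gen_code daha_gen_decode.
Proof. by case. Qed.

HB.instance Definition _ := Choice.copy daha_gen (can_type daha_gen_codeK).

Lemma rmorph_comm (A : nzRingType) (B : comNzRingType) (f : {rmorphism A -> B})
  (a b : A) : f (a * b) = f (b * a).
Proof. by rewrite !rmorphM mulrC. Qed.

Lemma rmorph_mul11 (A B : nzRingType) (f : {rmorphism A -> B}) (a b : A) :
  f a = 1 -> f b = 1 -> f (a * b) = f 1.
Proof. by move=> fa fb; rewrite rmorphM fa fb mulr1 rmorph1. Qed.

Lemma invr_uniq (A : unitRingType) (u v : A) :
  u * v = 1 -> v * u = 1 -> u \is a GRing.unit /\ u^-1 = v.
Proof.
move=> uv vu; have Uu : u \is a GRing.unit by apply/unitrP; exists v.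
by split=> //; apply: (mulrI Uu); rewrite uv divrr.
Qed.

Lemma malg_scaleAr (K : monomType) (R : comNzRingType) (a : R)
  (p q : {malg R[K]}) : a *: (p * q) = p * (a *: q).
Proof.
apply/malgP => k; rewrite mcoeffZ.
rewrite (mcoeffMlw k (fsubset_refl (msupp p)) (fsubset_refl (msupp q))).
rewrite (mcoeffMlw k (fsubset_refl (msupp p)) (msuppZ_le a q)).
rewrite mulr_sumr; apply: eq_bigr => i _; rewrite mulr_sumr.
by apply: eq_bigr => j _; rewrite mcoeffZ mulrnAr mulrCA.
Qed.

Section DAHA.
Variable F : fieldType.

Definition daha_free := {malg F[{fmonom daha_gen}]}.
HB.instance Definition _ := GRing.Lalgebra.on daha_free.

Definition fvar (g : daha_gen) : daha_free := << fmu g >>.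

Inductive daha_rel : daha_free -> daha_free -> Prop :=
  | rel_tV i : daha_rel (fvar (GT i) * fvar (GTinv i)) 1
  | rel_Vt i : daha_rel (fvar (GTinv i) * fvar (GT i)) 1
  | rel_tvV i : daha_rel (fvar (GTv i) * fvar (GTvinv i)) 1
  | rel_Vtv i : daha_rel (fvar (GTvinv i) * fvar (GTv i)) 1
  | rel_t_central i (p : daha_free) :
      let c := fvar (GT i) + fvar (GTinv i) in daha_rel (c * p) (p * c)
  | rel_tv_central i (p : daha_free) :
      let c := fvar (GTv i) + fvar (GTvinv i) in daha_rel (c * p) (p * c)
  | rel_prod_central (p : daha_free) :
      let c := fvar (GTv 0) * fvar (GT 0) * fvar (GTv 1) * fvar (GT 1) in
      daha_rel (c * p) (p * c).

(* Two-sided ideal generated by the relations. It is automatically stable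
   under scalars and opposites, since c *: p = (c *: 1) * p * 1. *)
Inductive daha_ideal : daha_free -> Prop :=
  | daha_ideal_rel p q : daha_rel p q -> daha_ideal (p - q)
  | daha_ideal0 : daha_ideal 0
  | daha_idealD p q : daha_ideal p -> daha_ideal q -> daha_ideal (p + q)
  | daha_idealM a p b : daha_ideal p -> daha_ideal (a * p * b).

Definition daha_idealb : {pred daha_free} := fun p => `[< daha_ideal p >].

Lemma daha_idealbP p : reflect (daha_ideal p) (p \in daha_idealb).
Proof. exact: asboolP. Qed.

Lemma daha_idealMl a p : daha_ideal p -> daha_ideal (a * p).
Proof. by move=> Ip; rewrite -[a * p]mulr1; apply: daha_idealM. Qed.

Lemma daha_idealMr p b : daha_ideal p -> daha_ideal (p * b).
Proof. by move=> Ip; rewrite -[p]mul1r; apply: daha_idealM. Qed.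

Lemma daha_idealb_zmod : zmod_closed daha_idealb.
Proof.
split=> [|p q /daha_idealbP Ip /daha_idealbP Iq]; apply/daha_idealbP.
  exact: daha_ideal0.
by apply: daha_idealD => //; rewrite -mulN1r; apply: daha_idealMl.
Qed.

HB.instance Definition _ :=
  GRing.Lalgebra_isAlgebra.Build F daha_free (@malg_scaleAr _ _).

HB.instance Definition _ :=
  GRing.isZmodClosed.Build daha_free daha_idealb daha_idealb_zmod.

Definition trivial_char (m : {fmonom daha_gen}) : F := 1.

Lemma trivial_char_morph : mmorphism trivial_char.
Proof. by split=> [x y|] //; rewrite /trivial_char mulr1. Qed.

HB.instance Definition _ :=
  isMultiplicative.Build {fmonom daha_gen} F trivial_char trivial_char_morph.

Definition augmentation : {rmorphism daha_free -> F} :=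
  mmap (@idfun F) trivial_char.

Lemma augmentation_fvar g : augmentation (fvar g) = 1.
Proof. by rewrite /augmentation /= mmapU mulr1. Qed.

Lemma augmentation_rel p q : daha_rel p q -> augmentation p = augmentation q.
Proof.
have E g h : augmentation (fvar g * fvar h) = augmentation 1.
  by apply: rmorph_mul11; apply: augmentation_fvar.
by case=> [i|i|i|i|i r|i r|r] /=; first [exact: E|exact: rmorph_comm].
Qed.

Lemma augmentation_ideal p : daha_ideal p -> augmentation p = 0.
Proof.
elim=> {p} [p q r|| p q _ Ip _ Iq|a p b _ Ip].
- by rewrite (rmorphB augmentation) (augmentation_rel r) subrr.
- exact: (rmorph0 augmentation).
- by rewrite (rmorphD augmentation) Ip Iq addr0.
- by rewrite (rmorphM augmentation) (rmorphM augmentation) Ip mulr0 mul0r.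
Qed.

(* The universal double affine Hecke algebra of type (C_1^vee, C_1). *)
Definition daha := {quot daha_idealb}.
HB.instance Definition _ := EqQuotient.on daha.
HB.instance Definition _ := Choice.on daha.
HB.instance Definition _ := GRing.Zmodule.on daha.
HB.instance Definition _ := ZmodQuotient.on daha.

Definition daha_pi (p : daha_free) : daha := \pi_daha p.

Lemma daha_piP p q : daha_pi p = daha_pi q <-> daha_ideal (p - q).
Proof.
rewrite /daha_pi; split=> [/eqP|I].
  by rewrite -idealrBE => /daha_idealbP.
by apply/eqP; rewrite -idealrBE; apply/daha_idealbP.
Qed.

Lemma daha_piD p q : daha_pi (p + q) = daha_pi p + daha_pi q.
Proof. exact: pi_addr. Qed.

Lemma daha_reprK u : daha_pi (repr u) = u.
Proof. exact: reprK. Qed.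

Definition daha_one : daha := daha_pi 1.
Definition daha_mul : daha -> daha -> daha :=
  locked (fun u v => daha_pi (repr u * repr v)).
Definition daha_scale : F -> daha -> daha :=
  locked (fun c u => daha_pi (c *: repr u)).

Lemma daha_repr_pi p : daha_ideal (repr (daha_pi p) - p).
Proof. by apply/daha_piP; rewrite daha_reprK. Qed.

Lemma daha_mulE p q : daha_mul (daha_pi p) (daha_pi q) = daha_pi (p * q).
Proof.
rewrite /daha_mul -lock; apply/daha_piP.
set p' := repr _; set q' := repr _.
have -> : p' * q' - p * q = (p' - p) * q' + p * (q' - q).
  by rewrite mulrBl mulrBr addrA subrK.
by apply: daha_idealD; [apply: daha_idealMr|apply: daha_idealMl];
   apply: daha_repr_pi.
Qed.

Lemma daha_scaleE c p : daha_scale c (daha_pi p) = daha_pi (c *: p).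
Proof.
rewrite /daha_scale -lock; apply/daha_piP; rewrite -scalerBr -[_ - _]mul1r scalerAl.
by apply: daha_idealMl; apply: daha_repr_pi.
Qed.

Let dahaE := (daha_mulE, daha_scaleE, =^~ daha_piD).

Lemma daha_mulA : associative daha_mul.
Proof.
move=> u v w; rewrite -[u]daha_reprK -[v]daha_reprK -[w]daha_reprK.
by rewrite !dahaE mulrA.
Qed.

Lemma daha_mul1 : left_id daha_one daha_mul.
Proof. by move=> u; rewrite -[u]daha_reprK !dahaE mul1r. Qed.

Lemma daha_mulr1 : right_id daha_one daha_mul.
Proof. by move=> u; rewrite -[u]daha_reprK !dahaE mulr1. Qed.

Lemma daha_mulDl : left_distributive daha_mul +%R.
Proof.
move=> u v w; rewrite -[u]daha_reprK -[v]daha_reprK -[w]daha_reprK.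
by rewrite !dahaE mulrDl.
Qed.

Lemma daha_mulDr : right_distributive daha_mul +%R.
Proof.
move=> u v w; rewrite -[u]daha_reprK -[v]daha_reprK -[w]daha_reprK.
by rewrite !dahaE mulrDr.
Qed.

Lemma daha_one_neq0 : daha_one != 0.
Proof.
have -> : 0 = daha_pi 0 by rewrite /daha_pi pi_zeror.
apply/eqP => /daha_piP /augmentation_ideal /eqP.
by rewrite subr0 rmorph1 oner_eq0.
Qed.

HB.instance Definition _ := GRing.Zmodule_isNzRing.Build daha
  daha_mulA daha_mul1 daha_mulr1 daha_mulDl daha_mulDr daha_one_neq0.

Lemma daha_scaleA a b v : daha_scale a (daha_scale b v) = daha_scale (a * b) v.
Proof. by rewrite -[v]daha_reprK !dahaE scalerA. Qed.

Lemma daha_scale1 : left_id 1 daha_scale.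
Proof. by move=> v; rewrite -[v]daha_reprK !dahaE scale1r. Qed.

Lemma daha_scaleDr : right_distributive daha_scale +%R.
Proof.
by move=> a u v; rewrite -[u]daha_reprK -[v]daha_reprK !dahaE scalerDr.
Qed.

Lemma daha_scaleDl v : {morph daha_scale^~ v : a b / a + b}.
Proof. by move=> a b; rewrite -[v]daha_reprK !dahaE scalerDl. Qed.

HB.instance Definition _ := GRing.Zmodule_isLmodule.Build F daha
  daha_scaleA daha_scale1 daha_scaleDr daha_scaleDl.

Lemma daha_piM p q : daha_pi (p * q) = daha_pi p * daha_pi q.
Proof. by rewrite -daha_mulE. Qed.

Lemma daha_pi1 : daha_pi 1 = 1. Proof. by []. Qed.

Lemma daha_piZ c p : daha_pi (c *: p) = c *: daha_pi p.
Proof. by rewrite -daha_scaleE. Qed.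

Lemma daha_scaleAl (a : F) (u v : daha) : a *: (u * v) = (a *: u) * v.
Proof.
rewrite -(daha_reprK u) -(daha_reprK v); set p := repr u; set q := repr v.
by rewrite -(daha_piM p q) -(daha_piZ a p) -(daha_piM _ q) -(daha_piZ a (p * q))
           scalerAl.
Qed.

HB.instance Definition _ :=
  GRing.Lmodule_isLalgebra.Build F daha daha_scaleAl.

Lemma daha_scaleAr (a : F) (u v : daha) : a *: (u * v) = u * (a *: v).
Proof.
rewrite -(daha_reprK u) -(daha_reprK v); set p := repr u; set q := repr v.
by rewrite -(daha_piM p q) -(daha_piZ a q) -(daha_piM p _) -(daha_piZ a (p * q))
           malg_scaleAr.
Qed.

HB.instance Definition _ :=
  GRing.Lalgebra_isAlgebra.Build F daha daha_scaleAr.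

Definition daha_is_inv (u v : daha) : Prop := v * u = 1 /\ u * v = 1.

Definition daha_unit : pred daha := fun u => `[< exists v, daha_is_inv u v >].

Definition daha_inv (u : daha) : daha :=
  if pselect (exists v, daha_is_inv u v) is left ex then projT1 (cid ex) else u.

Lemma daha_invP u : daha_unit u -> daha_is_inv u (daha_inv u).
Proof.
by move=> /asboolP ex; rewrite /daha_inv; case: pselect => // e; case: cid.
Qed.

Lemma daha_mulV : {in daha_unit, left_inverse 1 daha_inv *%R}.
Proof. by move=> u /daha_invP[]. Qed.

Lemma daha_divr : {in daha_unit, right_inverse 1 daha_inv *%R}.
Proof. by move=> u /daha_invP[]. Qed.

Lemma daha_unitP (u v : daha) : v * u = 1 /\ u * v = 1 -> daha_unit u.
Proof. by move=> uv; apply/asboolP; exists v. Qed.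

Lemma daha_inv_out : {in [predC daha_unit], daha_inv =1 id}.
Proof.
by move=> u /asboolPn nu; rewrite /daha_inv; case: pselect.
Qed.

HB.instance Definition _ := GRing.NzRing_hasMulInverse.Build daha
  daha_mulV daha_divr daha_unitP daha_inv_out.

HB.instance Definition _ := GRing.UnitAlgebra.on daha.

Definition daha_t (i : 'I_2) : daha := daha_pi (fvar (GT i)).
Definition daha_tv (i : 'I_2) : daha := daha_pi (fvar (GTv i)).

(* MathComp sets x^-1 = x for non-units; the next lemmas show that all
   inverses used are genuine, and that the formal inverse generators are the
   inverses of the daha_t i and daha_tv i. *)
Lemma daha_relE p q : daha_rel p q -> daha_pi p = daha_pi q.
Proof. by move=> r; apply/daha_piP; apply: daha_ideal_rel. Qed.

Lemma daha_tV i : daha_t i \is a GRing.unit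
  /\ (daha_t i)^-1 = daha_pi (fvar (GTinv i)).
Proof.
apply: invr_uniq; rewrite -daha_piM -daha_pi1; apply: daha_relE.
  exact: rel_tV.
exact: rel_Vt.
Qed.

Lemma daha_tvV i : daha_tv i \is a GRing.unit
  /\ (daha_tv i)^-1 = daha_pi (fvar (GTvinv i)).
Proof.
apply: invr_uniq; rewrite -daha_piM -daha_pi1; apply: daha_relE.
  exact: rel_tvV.
exact: rel_Vtv.
Qed.

Lemma daha_prod_unit :
  daha_tv 0 * daha_t 0 * daha_tv 1 * daha_t 1 \is a GRing.unit.
Proof.
by rewrite !unitrMl ?(daha_tV _).1 ?(daha_tvV _).1.
Qed.

Lemma daha_t_central i (u : daha) :
  (daha_t i + (daha_t i)^-1) * u = u * (daha_t i + (daha_t i)^-1).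
Proof.
rewrite (daha_tV i).2 -[u]daha_reprK -daha_piD -!daha_piM.
exact/daha_relE/rel_t_central.
Qed.

Lemma daha_tv_central i (u : daha) :
  (daha_tv i + (daha_tv i)^-1) * u = u * (daha_tv i + (daha_tv i)^-1).
Proof.
rewrite (daha_tvV i).2 -[u]daha_reprK -daha_piD -!daha_piM.
exact/daha_relE/rel_tv_central.
Qed.

Lemma daha_prod_central (u : daha) :
  let c := daha_tv 0 * daha_t 0 * daha_tv 1 * daha_t 1 in c * u = u * c.
Proof.
rewrite /= -[u]daha_reprK -!daha_piM.
exact/daha_relE/rel_prod_central.
Qed.

Definition daha_Q : daha := (daha_tv 0 * daha_t 0 * daha_tv 1 * daha_t 1)^-1.

End DAHA.

(* Main.v *)
(* With (a, b, c, d) = (t0v, t0, t1v, t1) one has abcd = Q^-1, so that cd and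
   bc can be traded for Q^-1 (ab)^-1 and Q^-1 (da)^-1; this reduces Q x y to a
   combination of z and short words. The anti-automorphism inverting a, b, c, d
   and Q fixes x, y, z, hence gives Q^-1 y x as well, and the difference is the
   first relation. The other two follow from the substitution
   (a, b, c) -> (d^-1 c d, a, b), which preserves abcd, and which maps
   x -> y -> z -> x because cd + (cd)^-1 = dc + (dc)^-1. *)

Require Import Defs.
From mathcomp Require Import all_boot all_algebra ssrAC.
Local Open Scope ring_scope.

Set Implicit Arguments.
Unset Strict Implicit.
Unset Printing Implicit Defensive.

Import GRing.Theory.

Definition central (R : unitRingType) (u : R) := forall v, u * v = v * u.

(** With d = [t1], the elements x, y, z are [loop a d] for a = [tv0], [tv1], [t0] respectively. *)
Definition loop (R : unitRingType) (a d : R) := a * d + (a * d)^-1.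

Lemma central_inv (R : unitRingType) (u : R) : central u -> central u^-1.
Proof. by move=> cu v; apply/esym/commrV/esym/cu. Qed.

Lemma central_addB (R : unitRingType) (u v w : R) :
  central (u + v) -> u * w - w * u = w * v - v * w.
Proof.
move=> cuv; apply/eqP; rewrite subr_eq addrAC eq_sym subr_eq -mulrDl -mulrDr.
by rewrite cuv addrC.
Qed.

(** Replacing a by a^-1 flips the sign of the commutator of a and d, because a + a^-1 is central;
    replacing d by d^-1 flips it back. Hence ad - da = a^-1 d^-1 - d^-1 a^-1, which rearranges to
    the claim. *)
Lemma loopC (R : unitRingType) (a d : R) :
  a \is a GRing.unit -> d \is a GRing.unit ->
  central (a + a^-1) -> central (d + d^-1) -> loop a d = loop d a.
Proof.
move=> Ua Ud cA cD; rewrite /loop !invrM //.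
have: a * d - d * a = a^-1 * d^-1 - d^-1 * a^-1.
  by rewrite (central_addB _ cA) -[LHS]opprB -(central_addB _ cD) opprB.
by move/eqP; rewrite subr_eq addrAC eq_sym subr_eq addrC => /eqP ->.
Qed.

(** Bookkeeping for subtracting the formulas for Q x y and Q^-1 y x: t, t' are the multiples of
    [loop b d], while v and w stand for [q * (a * c)] and [q^-1 * (c^-1 * a^-1)], which occur in
    both and cancel. *)
Lemma subr_cross_cancel (V : zmodType) (s t D u v w s' t' E u' : V) :
  (s - t + D + (u - v) - w) - (s' - t' + E + (u' - w) - v) + (t - t')
  = u - u' + ((D - s') + (s - E)).
Proof.
rewrite !(opprD, opprK, addrA).
rewrite [LHS](ACl (4*10*3*7*1*9*(13*2)*(12*5)*(11*6)*(8*14))) /=.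
by rewrite !subrr !addr0.
Qed.

Lemma four_units_mulxy (R : unitRingType) (a b c d q : R) :
  a \is a GRing.unit -> b \is a GRing.unit -> c \is a GRing.unit ->
  d \is a GRing.unit -> q \is a GRing.unit ->
  central (a + a^-1) -> central (b + b^-1) -> central (c + c^-1) ->
  central (d + d^-1) -> central q ->
  a * b * c * d = q^-1 ->
  q * loop a d * loop c d
  = q ^+ 2 * ((b + b^-1) * d^-1) - q ^+ 2 * loop b d + (b + b^-1) * d
    + (q * ((a + a^-1) * (c + c^-1)) - q * (a * c)) - q^-1 * (c^-1 * a^-1).
Proof.
move=> Ua Ub Uc Ud Uq cA cB cC cD cq abcd.
have cqV := central_inv cq.
have bcd : b * c * d = q^-1 * a^-1.
  by rewrite cqV -abcd -!mulrA mulKr.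
have bc : b * c = q^-1 * a^-1 * d^-1 by rewrite -bcd mulrK.
have cbV : c^-1 * b^-1 = q * d * a.
  by rewrite -invrM // bc -!mulrA -invrM // invrM ?invrK ?unitrV ?unitrMl // cq mulrA.
have ab : a * b = q^-1 * (d^-1 * c^-1) by rewrite -abcd -!mulrA mulVKr // mulrV // mulr1.
have cdV : (c * d)^-1 = q * (a * b) by rewrite ab mulVKr // invrM.
(* The second factor [loop c d] is split into c d and its inverse; the products of [loop a d] with
   the two are reduced separately, here and in [xcd]. *)
have xcdV : loop a d * (c * d)^-1 = a * c^-1 + q * (d^-1 * b).
  rewrite cdV mulrA -cq /loop -mulrA mulrDl invrM // -[d^-1 * _ * _]mulrA mulKr //.
  rewrite ab mulrDr; congr (_ + _).
  by rewrite [a * d * _]mulrA -(cqV (a * d)) -[q^-1 * _ * _]mulrA mulVKr // -mulrA mulVKr.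
(* Write d a = q^-1 c^-1 b^-1 and b^-1 = (b + b^-1) - b: the central part lets c^-1 meet c, and the
   rest contains b c d = q^-1 a^-1. *)
have dacd : d * a * c * d = q^-1 * ((b + b^-1) * d) - q^-1 * (q^-1 * (c^-1 * a^-1)).
  have -> : d * a = q^-1 * (c^-1 * b^-1) by rewrite cbV -[q * d * a]mulrA mulKr.
  have {1}-> : b^-1 = (b + b^-1) - b by rewrite addrC addKr.
  rewrite -mulrBr -!mulrA; congr (_ * _).
  rewrite mulrBl mulrBr (cB (c * d)) -!mulrA mulKr // -cB; congr (_ - _).
  by rewrite [b * (c * d)]mulrA bcd !mulrA (cqV c^-1).
(* Splitting the second c as (c + c^-1) - c^-1 leaves b c d times a central element, and b d. *)
have bccd : b * c * c * d = q^-1 * ((c + c^-1) * a^-1) - b * d.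
  have {2}-> : c = (c + c^-1) - c^-1 by rewrite addrK.
  rewrite mulrBr mulrBl mulrK // -(cC (b * c)) -mulrA bcd.
  by rewrite !mulrA (cqV (c + c^-1)).
(* The order of a and d is swapped first because a^-1 d^-1, unlike d^-1 a^-1, equals q b c. *)
have xcd : loop a d * (c * d) = d * a * c * d + q * (b * c * c * d).
  rewrite loopC // /loop mulrDl invrM //; congr (_ + _); first by rewrite !mulrA.
  have -> : a^-1 * d^-1 = q * (b * c) by rewrite bc -mulrA mulVKr.
  by rewrite !mulrA.
(* This is where z enters: q d^-1 b from [xcdV] and -q b d from [bccd] combine into it. *)
have zE : (b + b^-1) * d^-1 - loop b d = d^-1 * b - b * d.
  by rewrite /loop invrM // cB mulrDr [b * d + _]addrC opprD addrA addrK.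
have acE : (a + a^-1) * (c + c^-1) - a * c = a * c^-1 + (c + c^-1) * a^-1.
  by rewrite mulrDl -(cC a^-1) mulrDr [a * c + _]addrC addrAC addrK.
rewrite -mulrA {2}/loop mulrDr xcd xcdV dacd bccd -!mulrBr zE acE.
rewrite !(mulrDr, mulrN) !(mulVKr Uq) expr2 -!mulrA !addrA.
by rewrite [LHS](ACl (6*4*1*5*3*2)).
Qed.

(** The anti-automorphism is realised by applying [four_units_mulxy] in the opposite ring [R^c] to
    the inverses of a, b, c, d, q, which satisfy the same hypotheses there; thus R itself need not
    carry such a map. *)
Lemma four_units_mulyx (R : unitRingType) (a b c d q : R) :
  a \is a GRing.unit -> b \is a GRing.unit -> c \is a GRing.unit ->
  d \is a GRing.unit -> q \is a GRing.unit ->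
  central (a + a^-1) -> central (b + b^-1) -> central (c + c^-1) ->
  central (d + d^-1) -> central q ->
  a * b * c * d = q^-1 ->
  q^-1 * loop c d * loop a d
  = q ^- 2 * ((b + b^-1) * d) - q ^- 2 * loop b d + (b + b^-1) * d^-1
    + (q^-1 * ((a + a^-1) * (c + c^-1)) - q^-1 * (c^-1 * a^-1)) - q * (a * c).
Proof.
move=> Ua Ub Uc Ud Uq cA cB cC cD cq abcd.
have loopV (u : R) : u \is a GRing.unit -> @loop R^c u^-1 d^-1 = loop u d.
  move=> Uu; rewrite /loop; change (d^-1 * u^-1 + (d^-1 * u^-1)^-1 = u * d + (u * d)^-1).
  by rewrite -invrM // invrK addrC.
have sumV (u : R) : u^-1 + u^-1^-1 = u + u^-1 by rewrite invrK addrC.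
have centralV (u : R) : central (u + u^-1) -> @central R^c (u^-1 + u^-1^-1).
  by rewrite sumV => cu v; apply/esym/cu.
have abcdV : (a^-1 : R^c) * b^-1 * c^-1 * d^-1 = q^-1^-1.
  change (d^-1 * (c^-1 * (b^-1 * a^-1)) = q^-1^-1).
  by rewrite -abcd !invrM ?unitrMl // !mulrA.
have cqV : @central R^c q^-1 by move=> v; apply/esym/(central_inv cq).
have unitVc (u : R) : u \is a GRing.unit -> (u^-1 : R^c) \is a GRing.unit.
  by move=> Uu; change (u^-1 \is a GRing.unit); rewrite unitrV.
have := four_units_mulxy (unitVc _ Ua) (unitVc _ Ub) (unitVc _ Uc) (unitVc _ Ud)
  (unitVc _ Uq) (centralV _ cA) (centralV _ cB) (centralV _ cC) (centralV _ cD) cqV abcdV.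
rewrite !loopV //.
(* Products of [R^c] are restated as reversed products of R, so that rewriting in R applies. *)
change (loop c d * (loop a d * q^-1)
  = d^-1^-1 * (b^-1 + b^-1^-1) * q^-1 ^+ 2 - loop b d * q^-1 ^+ 2
    + d^-1 * (b^-1 + b^-1^-1)
    + ((c^-1 + c^-1^-1) * (a^-1 + a^-1^-1) * q^-1 - c^-1 * a^-1 * q^-1)
    - a^-1^-1 * c^-1^-1 * q^-1^-1 ->
  q^-1 * loop c d * loop a d
  = q ^- 2 * ((b + b^-1) * d) - q ^- 2 * loop b d + (b + b^-1) * d^-1
    + (q^-1 * ((a + a^-1) * (c + c^-1)) - q^-1 * (c^-1 * a^-1)) - q * (a * c)).
have cqV' := central_inv cq.
have cq2 : central (q ^- 2) by rewrite -exprVn expr2 => v; rewrite -mulrA !cqV' mulrA.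
by rewrite mulrA -cqV' mulrA !sumV !invrK exprVn -!cq2 -!cqV' -cq -!cB cC.
Qed.

Lemma four_units_relation (R : unitRingType) (a b c d q : R) :
  a \is a GRing.unit -> b \is a GRing.unit -> c \is a GRing.unit ->
  d \is a GRing.unit -> q \is a GRing.unit ->
  central (a + a^-1) -> central (b + b^-1) -> central (c + c^-1) ->
  central (d + d^-1) -> central q ->
  a * b * c * d = q^-1 ->
  q * loop a d * loop c d - q^-1 * loop c d * loop a d
    + (q ^+ 2 - q ^- 2) * loop b d
  = (q - q^-1) * ((a + a^-1) * (c + c^-1)
                  + (b + b^-1) * (q^-1 * d + q * d^-1)).
Proof.
move=> Ua Ub Uc Ud Uq cA cB cC cD cq abcd.
rewrite (@four_units_mulxy _ a b c d q) // (@four_units_mulyx _ a b c d q) //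
  [in LHS]mulrBl subr_cross_cancel.
rewrite [RHS]mulrDr -mulrBl; congr (_ + _).
have cqV := central_inv cq.
have -> : (b + b^-1) * (q^-1 * d + q * d^-1)
    = q^-1 * ((b + b^-1) * d) + q * ((b + b^-1) * d^-1).
  by rewrite mulrDr !(mulrA (b + b^-1)) -cqV -cq !mulrA.
(* The coefficients match since (q - q^-1) q^-1 = 1 - q^-2 and (q - q^-1) q = q^2 - 1. *)
rewrite [RHS]mulrDr !mulrBl (mulVKr Uq) (mulKr Uq) !mulrA.
by rewrite -!expr2 exprVn -!mulrA.
Qed.

(** A central product is unchanged by the cyclic shift to c d a b; conjugating by d then puts d last
    again. *)
Lemma four_units_rotate (R : unitRingType) (a b c d q : R) :
  a \is a GRing.unit -> b \is a GRing.unit -> d \is a GRing.unit ->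
  central q -> a * b * c * d = q^-1 -> d^-1 * c * d * a * b * d = q^-1.
Proof.
move=> Ua Ub Ud cq abcd.
have cdab : c * d * (a * b) = q^-1.
  have Uab : a * b \is a GRing.unit by rewrite unitrMl.
  by apply: (mulrI Uab); rewrite -(central_inv cq) -abcd !mulrA.
have -> : d^-1 * c * d * a * b * d = d^-1 * (c * d * (a * b)) * d by rewrite !mulrA.
by rewrite cdab -(central_inv cq) mulrVK.
Qed.

Lemma conj_addV (R : unitRingType) (c d : R) :
  c \is a GRing.unit -> d \is a GRing.unit -> central (c + c^-1) ->
  d^-1 * c * d + (d^-1 * c * d)^-1 = c + c^-1.
Proof.
move=> Uc Ud cC; rewrite !invrM ?unitrMl ?unitrV // invrK mulrA -mulrDl -mulrDr.
by rewrite -cC mulrVK.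
Qed.

(** After [loopC], the product d (d^-1 c d) collapses to c d. *)
Lemma loop_conj (R : unitRingType) (c d : R) :
  c \is a GRing.unit -> d \is a GRing.unit ->
  central (c + c^-1) -> central (d + d^-1) ->
  loop (d^-1 * c * d) d = loop c d.
Proof.
move=> Uc Ud cC cD; rewrite loopC ?conj_addV // ?unitrMl ?unitrV //.
by rewrite /loop -mulrA mulVKr.
Qed.

Theorem theorem5p2 (F : fieldType) :
  let t0 : daha F := daha_t F 0 in
  let t1 : daha F := daha_t F 1 in
  let tv0 : daha F := daha_tv F 0 in
  let tv1 : daha F := daha_tv F 1 in
  let Q : daha F := daha_Q F in
  let x := tv0 * t1 + (tv0 * t1)^-1 in
  let y := tv1 * t1 + (tv1 * t1)^-1 in
  let z := t0 * t1 + (t0 * t1)^-1 in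
  [/\ Q * x * y - Q^-1 * y * x + (Q ^+ 2 - Q ^- 2) * z
      = (Q - Q^-1) * ((tv0 + tv0^-1) * (tv1 + tv1^-1)
                      + (t0 + t0^-1) * (Q^-1 * t1 + Q * t1^-1)),
      Q * y * z - Q^-1 * z * y + (Q ^+ 2 - Q ^- 2) * x
      = (Q - Q^-1) * ((tv1 + tv1^-1) * (t0 + t0^-1)
                      + (tv0 + tv0^-1) * (Q^-1 * t1 + Q * t1^-1))
    & Q * z * x - Q^-1 * x * z + (Q ^+ 2 - Q ^- 2) * y
      = (Q - Q^-1) * ((t0 + t0^-1) * (tv0 + tv0^-1)
                      + (tv1 + tv1^-1) * (Q^-1 * t1 + Q * t1^-1))].
Proof.
move=> t0 t1 tv0 tv1 Q x y z.
have [Ut0 Ut1] := ((daha_tV F 0).1, (daha_tV F 1).1).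
have [Utv0 Utv1] := ((daha_tvV F 0).1, (daha_tvV F 1).1).
have [ct0 ct1] := (@daha_t_central F 0, @daha_t_central F 1).
have [ctv0 ctv1] := (@daha_tv_central F 0, @daha_tv_central F 1).
rewrite -/t0 -/t1 -/tv0 -/tv1 in Ut0 Ut1 Utv0 Utv1 ct0 ct1 ctv0 ctv1.
have QV : tv0 * t0 * tv1 * t1 = Q^-1 by rewrite /Q /daha_Q invrK.
have UQ : Q \is a GRing.unit by rewrite unitrV daha_prod_unit.
have cQ : central Q by apply: central_inv; apply: daha_prod_central.
have conjU u : u \is a GRing.unit -> t1^-1 * u * t1 \is a GRing.unit.
  by move=> Uu; rewrite !unitrMl ?unitrV.
(* One and two rotations give the quadruples for the second and third relations. *)
have QV2 := four_units_rotate Utv0 Ut0 Ut1 cQ QV.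
have QV3 := four_units_rotate (conjU _ Utv1) Utv0 Ut1 cQ QV2.
split.
- exact: four_units_relation.
- have := @four_units_relation _ (t1^-1 * tv1 * t1) tv0 t0 t1 Q.
  rewrite loop_conj // conj_addV //; apply=> //; exact: conjU.
- have := @four_units_relation _ (t1^-1 * t0 * t1) (t1^-1 * tv1 * t1) tv0 t1 Q.
  rewrite !loop_conj // !conj_addV //; apply=> //; exact: conjU.
Qed.
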